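(* Let $G$ be a planar $st$-digraph. Then $G$ has a hamiltonian path if and only if $G$ contains neither a strong rhombus nor a weak rhombus.
   Context: An $st$-digraph is a finite acyclic digraph with exactly one source $s$ (in-degree $0$) and exactly one sink $t$ (out-degree $0$). A planar $st$-digraph is an $st$-digraph together with a fixed planar embedding in which $s$ and $t$ lie on the external face; it is drawn upward (every edge is a curve strictly increasing in the vertical direction). A hamiltonian path is a directed path visiting every vertex exactly once. Every internal face $f$ of a planar $st$-digraph is bounded by two directed paths (its left side and its right side) from a common face source to a common face sink. A face is a generalized triangle if one of its sides is a single edge and the other side contains at least one vertex besides the face source and face sink; it is left-sided (resp. right-sided) if its left (resp. right) side is the longer one. $G$ contains a weak rhombus if some internal face of $G$ has at least one vertex other than its face source and face sink on each of its two sides. $G$ contains a strong rhombus if there is an edge $(s',t')$ of $G$ such that the face to its left is a left-sided generalized triangle whose right side is exactly the edge $(s',t')$ and the face to its right is a right-sided generalized triangle whose left side is exactly the edge $(s',t')$ (so both faces have face source $s'$ and face sink $t'$). *)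

(* Defs.v *)
From HB Require Import structures.
From mathcomp Require Import all_boot all_order all_algebra.
From mathcomp Require Import all_classical all_reals all_analysis.

Set Implicit Arguments.
Unset Strict Implicit.
Unset Printing Implicit Defensive.

Import Order.TTheory GRing.Theory Num.Theory.
Import numFieldNormedType.Exports.

Local Open Scope classical_set_scope.
Local Open Scope ring_scope.

(* Edges form a relation, so there are no parallel edges. *)
Record st_digraph := StDigraph {
  vertex :> finType;
  edge : rel vertex;
  st_source : vertex;
  st_sink : vertex;
  st_acyclic : forall c : seq vertex, cycle edge c -> c = [::];
  st_sourceP : forall v : vertex,
    #|[set u | edge u v]%SET| = 0%N <-> v = st_source;
  st_sinkP : forall v : vertex,
    #|[set w | edge v w]%SET| = 0%N <-> v = st_sink
}.

Arguments edge {s} : rename.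
Arguments st_source {s} : rename.
Arguments st_sink {s} : rename.

Definition hamiltonian_path (G : st_digraph) : Prop :=
  exists (x : G) (p : seq G),
    [/\ path edge x p, uniq (x :: p) & forall v : G, v \in x :: p].

(* [curve u v] is meaningful only when [edge u v], and only on [0, 1]. *)
Definition arc (R : realType) (G : st_digraph) (curve : G -> G -> R -> R * R)
    (u v : G) : set (R * R) :=
  curve u v @` `[0, 1].

Definition drawing_points (R : realType) (G : st_digraph) (pos : G -> R * R)
    (curve : G -> G -> R -> R * R) : set (R * R) :=
  [set z | (exists v : G, z = pos v) \/
           (exists u v : G, edge u v /\ arc curve u v z)].

(* The faces of a drawing [D] are the connected components of its complement. *)
Definition face_of (R : realType) (D F : set (R * R)) : Prop :=
  exists2 z : R * R, (~` D) z & F = connected_component (~` D) z.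

Record planar_st_digraph (R : realType) := PlanarStDigraph {
  psd_graph :> st_digraph;
  pos : psd_graph -> R * R;
  curve : psd_graph -> psd_graph -> R -> R * R;
  pos_inj : injective pos;
  curve_continuous : forall u v : psd_graph, edge u v ->
    {within `[0, 1], continuous (curve u v)};
  curve_start : forall u v : psd_graph, edge u v -> curve u v 0 = pos u;
  curve_end : forall u v : psd_graph, edge u v -> curve u v 1 = pos v;
  curve_upward : forall u v : psd_graph, edge u v ->
    forall a b : R, 0 <= a -> a < b -> b <= 1 ->
      (curve u v a).2 < (curve u v b).2;
  curve_avoids_vertices : forall u v w : psd_graph, edge u v ->
    forall a : R, 0 < a < 1 -> curve u v a <> pos w;
  curve_noncrossing : forall u v u' v' : psd_graph,
    edge u v -> edge u' v' -> (u, v) <> (u', v') ->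
    forall a b : R, 0 < a < 1 -> 0 < b < 1 -> curve u v a <> curve u' v' b;
  st_external : exists F : set (R * R),
    [/\ face_of (drawing_points pos curve) F, ~ bounded_set F,
        closure F (pos st_source) & closure F (pos st_sink)]
}.

Arguments pos {R} p _ : rename.
Arguments curve {R} p _ _ _ : rename.

Definition internal_face (R : realType) (G : planar_st_digraph R)
    (F : set (R * R)) : Prop :=
  face_of (drawing_points (pos G) (curve G)) F /\ bounded_set F.

(* A directed path from [a] to [b] is given by the sequence [p] of its
   vertices other than [a] and [b]; [p = [::]] is the single edge (a, b). *)
Definition dipath (G : st_digraph) (a : G) (p : seq G) (b : G) : Prop :=
  path edge a (rcons p b).

Definition path_points (R : realType) (G : planar_st_digraph R)
    (a : G) (p : seq G) (b : G) : set (R * R) :=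
  [set z | exists2 uv : G * G, uv \in zip (a :: p) (rcons p b)
                             & arc (curve G) uv.1 uv.2 z].

(* As edges are strictly increasing in the second coordinate, a directed path
   has at most one point at each height; [strip a p q b] is the set of points
   lying, at their own height, strictly to the right of the path through [p]
   and strictly to the left of the path through [q]. *)
Definition strip (R : realType) (G : planar_st_digraph R)
    (a : G) (p q : seq G) (b : G) : set (R * R) :=
  [set z | exists2 x : R, path_points a p b (x, z.2) & x < z.1] `&`
  [set z | exists2 x : R, path_points a q b (x, z.2) & z.1 < x].

(* [F] has face source [a], face sink [b], left side [p], right side [q]. *)
Definition face_sides (R : realType) (G : planar_st_digraph R)
    (F : set (R * R)) (a : G) (p q : seq G) (b : G) : Prop :=
  [/\ dipath a p b, dipath a q b, ~~ has (mem p) q & F = strip a p q b].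

Definition weak_rhombus (R : realType) (G : planar_st_digraph R) : Prop :=
  exists (F : set (R * R)) (a b : G) (p q : seq G),
    [/\ internal_face G F, face_sides F a p q b, p <> [::] & q <> [::]].

Definition left_sided_triangle (R : realType) (G : planar_st_digraph R)
    (F : set (R * R)) (a b : G) : Prop :=
  internal_face G F /\
  exists2 p : seq G, p <> [::] & face_sides F a p [::] b.

Definition right_sided_triangle (R : realType) (G : planar_st_digraph R)
    (F : set (R * R)) (a b : G) : Prop :=
  internal_face G F /\
  exists2 q : seq G, q <> [::] & face_sides F a [::] q b.

Definition strong_rhombus (R : realType) (G : planar_st_digraph R) : Prop :=
  exists (a b : G) (F F' : set (R * R)),
    [/\ edge a b, left_sided_triangle F a b & right_sided_triangle F' a b].

(* Main.v *)
(* At every height a directed path of an upward drawing has a unique abscissa,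
   which depends continuously on the height, and two paths can only meet at
   common vertices or along common edges.

   If a hamiltonian path existed next to a rhombus, it would join the interiors
   of the two sides of the rhombus at heights strictly between its source and
   its sink; by the intermediate value theorem it would enter the face (weak
   rhombus) or cross the middle edge (strong rhombus).

   Without a hamiltonian path there are incomparable vertices; take such a pair
   u, w at minimal difference of heights, with u to the left of w. If there is
   no weak rhombus, the face to the right of u has a single edge as right side,
   and by minimality this edge spans the height of w. Sweep rightwards towards w
   at that height: the next face again has a longer left side and a single edge
   on the right, unless it completes a rhombus. As edges are finitely many, the
   face reached just before w gives a rhombus.

   The face to the right of a point (x0, y0) of the drawing is found from the
   s-t paths: take P rightmost among those with P(y0) <= x0 and Q leftmost among
   those with Q(y0) > x0. An edge drawn between P and Q lies on an s-t path Z, and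
   max(P, Z) or min(Q, Z), which are again s-t paths, contradicts the choice. *)

Require Import Defs.
From mathcomp Require Import all_boot all_order all_algebra.
From mathcomp Require Import all_classical all_reals all_analysis.
From mathcomp Require Import lra.

Set Implicit Arguments.
Unset Strict Implicit.
Unset Printing Implicit Defensive.

Import Order.TTheory GRing.Theory Num.Theory.
Import numFieldNormedType.Exports.

Local Open Scope classical_set_scope.
Local Open Scope ring_scope.

(** Extremal tracks are later chosen among all sequences of vertices, an infinite type; a measure in
    [nat] makes the choice possible. *)
Lemma ex_min_measure (T : Type) (P : T -> Prop) (m : T -> nat) :
  (exists x, P x) -> exists x, P x /\ forall y, P y -> (m x <= m y)%N.
Proof.
move=> [x0 Px0].
have ex : exists n, `[< exists x, P x /\ m x = n >].
  by exists (m x0); apply/asboolP; exists x0.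
have [n /asboolP[x [Px <-]] mn] := ex_minnP ex.
by exists x; split=> // y Py; apply: mn; apply/asboolP; exists y.
Qed.

(** * Real analysis: upward curves as graphs, and crossings of graphs *)

Section Reals.
Variable R : realType.
Implicit Types f g : R -> R.

(** Clamping the argument extends the function by constants outside the segment, so that later
    functions are continuous everywhere. *)
Lemma continuous_clamp (T : topologicalType) (h : R -> T) (a b : R) :
  a <= b -> {within `[a, b], continuous h} ->
  continuous (fun t => h (Num.max a (Num.min b t))).
Proof.
move=> ab ch t.
have ct : continuous (fun t => Num.max a (Num.min b t)).
  move=> x; apply: continuous_max; first exact: cvg_cst.
  apply: continuous_min; [exact: cvg_cst|exact: cvg_id].
have clamp_in x : `[a, b]%classic (Num.max a (Num.min b x)).
  by rewrite /= in_itv /= le_max lexx /= ge_max ab ge_min lexx.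
move/subspace_continuousP: ch => /(_ _ (clamp_in t)) ch.
move=> U /ch; rewrite /within /= !nbhs_simpl /= => hU.
have := ct t _ hU; rewrite /= => {}hU.
apply: filterS (hU : nbhs t _) => x hx; apply: hx; exact: clamp_in.
Qed.

Lemma cross f g (y1 y2 : R) : continuous f -> continuous g ->
  f y1 <= g y1 -> g y2 <= f y2 ->
  exists y, [/\ Num.min y1 y2 <= y, y <= Num.max y1 y2 & f y = g y].
Proof.
move=> cf cg h1 h2.
have ck : continuous (fun y => f y - g y).
  by move=> x; apply: cvgB; [exact: cf|exact: cg].
wlog le12 : y1 y2 f g cf cg h1 h2 ck / y1 <= y2 => [hw|].
  case/orP: (le_total y1 y2) => [le12|le21].
    exact: hw.
  have ck' : continuous (fun y => g y - f y).
    by move=> x; apply: cvgB; [exact: cg|exact: cf].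
  have [y [? ? ?]] := hw y2 y1 g f cg cf h2 h1 ck' le21.
  by exists y; rewrite minC maxC; split.
rewrite (min_idPl le12) (max_idPr le12).
have [||y] := @IVT R (fun y => f y - g y) y1 y2 0 le12.
- exact: continuous_subspaceT.
- by rewrite ge_min le_max !subr_ge0 !subr_le0 h1 h2 orbT.
rewrite in_itv /= => /andP[? ?] /eqP; rewrite subr_eq0 => /eqP ?.
by exists y.
Qed.

(** The height along the curve is continuous and strictly increasing, so it has a continuous
    inverse; [f] is the abscissa of the curve composed with this inverse. *)
Lemma monotone_curve_graph (c : R -> R * R) :
  {within `[0, 1], continuous c} ->
  (forall a b, 0 <= a -> a < b -> b <= 1 -> (c a).2 < (c b).2) ->
  exists f, continuous f /\ forall z, (c @` `[0, 1]) z <->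
    [/\ (c 0).2 <= z.2, z.2 <= (c 1).2 & z.1 = f z.2].
Proof.
move=> cc cinc.
pose h t := (c t).2.
have le01 : 0 <= 1 :> R by exact: ler01.
have ch : {within `[0, 1], continuous h}.
  move=> t; apply: (@continuous_comp _ _ _ (c : subspace _ -> _) snd).
    exact: cc.
  exact: cvg_snd.
have hmono : {in `[0, 1] &, {mono h : x y / x <= y}}.
  apply: le_mono_in => x y; rewrite !in_itv /= => /andP[x0 x1] /andP[y0 y1] xy.
  exact: cinc.
have hinj : {in `[0, 1] &, injective h}.
  by move=> x y xi yi hxy; apply/eqP; rewrite eq_le -(hmono x y) // -(hmono y x) // hxy lexx.
(* The default is taken only for those [y] that [h] does not reach on the unit segment. *)
pose g y := xget 0 [set t | t \in `[0, 1] /\ h t = y].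
have gK : {in `[0, 1], cancel h g}.
  move=> t ti; have := @xgetPex _ 0 [set t' | t' \in `[0, 1] /\ h t' = h t].
  by move=> /(_ (ex_intro _ t (conj ti erefl))) [? ?]; apply: hinj.
have h01 : h 0 <= h 1 by rewrite hmono // in_itv /= ?lexx ler01.
have cg := segment_can_le_continuous le01 ch gK.
have hK := segment_continuous_le_can_sym le01 ch gK.
have g01 : {in `[h 0, h 1], forall y, g y \in `[0, 1]}.
  move=> y yi; have := @xgetPex _ 0 [set t' | t' \in `[0, 1] /\ h t' = y].
  have [||t ti ht] := @IVT R h 0 1 y le01 => //.
    by move: yi; rewrite in_itv /= (min_idPl h01) (max_idPr h01).
  by move=> /(_ (ex_intro _ t (conj ti ht))) [].
pose k t := c (Num.max 0 (Num.min 1 t)).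
exists (fun y => (k (g (Num.max (h 0) (Num.min (h 1) y)))).1); split.
  move=> y; apply: (@continuous_comp _ _ _
    (fun y => k (g (Num.max (h 0) (Num.min (h 1) y)))) fst); last exact: cvg_fst.
  apply: (@continuous_comp _ _ _
    (fun y => g (Num.max (h 0) (Num.min (h 1) y))) k).
    exact: (continuous_clamp h01 cg).
  exact: (continuous_clamp le01 cc).
have kE t : t \in `[0, 1] -> k t = c t.
  by rewrite in_itv /= /k => /andP[t0 t1]; rewrite (min_idPr t1) (max_idPr t0).
have clE y : h 0 <= y -> y <= h 1 -> Num.max (h 0) (Num.min (h 1) y) = y.
  by move=> y0 y1; rewrite (min_idPr y1) (max_idPr y0).
move=> z; split.
  case=> t ti <-; have hb : h 0 <= h t <= h 1.
    by move: (ti); rewrite /= in_itv /= => /andP[? ?];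
      rewrite !hmono // ?in_itv /= ?lexx ?ler01 //; apply/andP; split.
  case/andP: hb => hb1 hb2; split=> //.
  by rewrite clE // gK // kE.
case=> z0 z1; rewrite clE // => zE.
have zi : z.2 \in `[h 0, h 1] by rewrite in_itv /=; apply/andP.
exists (g z.2); first exact: g01.
rewrite kE in zE; last exact: g01.
have := hK _ zi; rewrite /h; move: zE; clear.
by case: z => z1 z2 /=; case: (c _) => ? ? /= -> ->.
Qed.


Lemma open_lt_comp (T : topologicalType) (j k : T -> R) :
  continuous j -> continuous k -> open [set z | j z < k z].
Proof.
move=> cj ck.
rewrite (_ : mkset _ = (fun z => k z - j z) @^-1` [set x | 0 < x]); last first.
  by apply/seteqP; split=> z /=; rewrite subr_gt0.
apply: open_comp; last exact: open_gt.
by move=> z _; apply: cvgB; [exact: ck|exact: cj].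
Qed.

Lemma closed_le_comp (T : topologicalType) (j k : T -> R) :
  continuous j -> continuous k -> closed [set z | j z <= k z].
Proof.
move=> cj ck; rewrite (_ : mkset _ = ~` [set z | k z < j z]).
  by apply: open_closedC; exact: open_lt_comp.
by apply/seteqP; split=> z /=; rewrite leNgt => /negP.
Qed.

Lemma continuous_pair (j k : R -> R) :
  continuous j -> continuous k -> continuous (fun t => (j t, k t) : R * R).
Proof.
move=> cj ck t.
by apply: (@cvg_pair _ _ _ _ (nbhs (j t)) (nbhs (k t))); [exact: cj|exact: ck].
Qed.

(** * The region enclosed by two graphs with common ends *)

Section Strip.
Variables (f g : R -> R) (h0 h1 : R).
Hypotheses (cf : continuous f) (cg : continuous g) (h01 : h0 < h1).
Hypotheses (fg0 : f h0 = g h0) (fg1 : f h1 = g h1).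
Hypothesis fg : forall y, h0 < y -> y < h1 -> f y < g y.

Definition region : set (R * R) :=
  [set z | [/\ h0 < z.2, z.2 < h1, f z.2 < z.1 & z.1 < g z.2]].

Let csnd (k : R -> R) : continuous k -> continuous (fun z : R * R => k z.2).
Proof.
move=> ck z; apply: (@continuous_comp _ _ _ (@snd R R) k).
  exact: cvg_snd.
exact: ck.
Qed.

Let cfst : continuous (@fst R R). Proof. by move=> z; exact: cvg_fst. Qed.
Let csnd' : continuous (@snd R R). Proof. by move=> z; exact: cvg_snd. Qed.
Let ccst (c : R) : continuous (fun z : R * R => c).
Proof. by move=> z; exact: cvg_cst. Qed.

Lemma open_region : open region.
Proof.
rewrite (_ : region = ([set z | h0 < z.2] `&` [set z | z.2 < h1]) `&`
    ([set z | f z.2 < z.1] `&` [set z | z.1 < g z.2])).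
  by do !apply: openI; apply: open_lt_comp => //; exact: csnd.
by apply/seteqP; split=> [z [] //|z [[? ?] [? ?]]].
Qed.

Lemma closed_region_hull :
  closed [set z : R * R | [/\ h0 <= z.2, z.2 <= h1, f z.2 <= z.1 & z.1 <= g z.2]].
Proof.
rewrite (_ : mkset _ = ([set z | h0 <= z.2] `&` [set z | z.2 <= h1]) `&`
    ([set z | f z.2 <= z.1] `&` [set z | z.1 <= g z.2])).
  by do !apply: closedI; apply: closed_le_comp => //; exact: csnd.
by apply/seteqP; split=> [z [] //|z [[? ?] [? ?]]].
Qed.

Lemma region_point y l : h0 < y -> y < h1 -> 0 < l -> l < 1 ->
  region (f y + l * (g y - f y), y).
Proof.
move=> y0 y1 l0 l1; have := fg y0 y1; rewrite -subr_gt0 => d0.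
split=> //=; first by rewrite ltrDl mulr_gt0.
by rewrite -ltrBrDl gtr_pMl.
Qed.

(** The region is a union of crosses: all share the horizontal segment [H] at mid-height, and each
    adds the curve [V l] running at a fixed proportion [l] between the two graphs. *)
Lemma connected_region : connected region.
Proof.
pose pt l y : R * R := (f y + l * (g y - f y), y).
have cpt l : continuous (pt l).
  apply: continuous_pair => y; last exact: cvg_id.
  apply: cvgD; first exact: cf.
  by apply: cvgM; [exact: cvg_cst|apply: cvgB; [exact: cg|exact: cf]].
have cpt' y : continuous (pt^~ y).
  apply: continuous_pair => l; last exact: cvg_cst.
  apply: cvgD; first exact: cvg_cst.
  by apply: cvgM; [exact: cvg_id|exact: cvg_cst].
pose ym := (h0 + h1) / 2.
have ym0 : h0 < ym by have := h01; rewrite /ym; lra.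
have ym1 : ym < h1 by have := h01; rewrite /ym; lra.
pose H := pt^~ ym @` `]0, 1[.
pose V l := pt l @` `]h0, h1[.
have cH : connected H.
  apply: connected_continuous_connected; last exact: continuous_subspaceT.
  by apply/connected_intervalP; exact: interval_is_interval.
have cV l : connected (V l).
  apply: connected_continuous_connected; last exact: continuous_subspaceT.
  by apply/connected_intervalP; exact: interval_is_interval.
have HV l : 0 < l -> l < 1 -> (H `&` V l) (pt l ym).
  by move=> l0 l1; split; [exists l|exists ym]; rewrite //= in_itv /=; apply/andP.
have half0 : 0 < 1 / 2 :> R by lra.
have half1 : 1 / 2 < 1 :> R by lra.
rewrite (_ : region = \bigcup_(l in [set l | 0 < l < 1]) (H `|` V l)).
  apply: bigcup_connected.
    by exists (pt (1 / 2) ym) => l _; left; case: (HV _ half0 half1).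
  move=> l /= /andP[l0 l1]; apply: connectedU => //.
  by exists (pt l ym); exact: HV.
apply/seteqP; split=> [[x y] /= [/= y0 y1 x0 x1]|z [l /= /andP[l0 l1]]].
  have d0 : 0 < g y - f y by rewrite subr_gt0; exact: fg.
  exists ((x - f y) / (g y - f y)) => /=.
    by rewrite divr_gt0 ?subr_gt0 ?fg //= ltr_pdivrMr // mul1r ltrD2r.
  right; exists y; first by rewrite /= in_itv /= y0.
  by rewrite /pt divfK ?gt_eqF // addrC subrK.
case=> -[r /=]; rewrite in_itv /= => /andP[r0 r1] <-; exact: region_point.
Qed.

Lemma bounded_region : bounded_set region.
Proof.
have cnorm (k : R -> R) :
    continuous k -> {within `[h0, h1], continuous (fun y => `|k y| : R)}.
  move=> ck.
  have cn : continuous (fun y => `|k y| : R).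
    move=> y.
    by apply: (@continuous_comp _ _ _ k); [exact: ck|exact: norm_continuous].
  exact: continuous_subspaceT.
have [c1 _ hc1] := EVT_max (ltW h01) (cnorm _ cf).
have [c2 _ hc2] := EVT_max (ltW h01) (cnorm _ cg).
exists (`|f c1| + `|g c2| + `|h0| + `|h1|); split; first exact: num_real.
move=> M /ltW BM [x y] [/= y0 y1 x0 x1].
have yi : y \in `[h0, h1] by rewrite in_itv /= !ltW.
have gc := hc2 _ yi; have fc := hc1 _ yi.
have between (p q r : R) : p < q -> q < r -> `|q| <= `|p| + `|r|.
  move=> pq qr; have := ler_norm (- p); have := ler_norm r.
  by rewrite normrN ler_norml; have := normr_ge0 r; have := normr_ge0 p => *;
    apply/andP; split; lra.
rewrite prod_normE /= (le_trans _ BM) // ge_max.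
have := between _ _ _ x0 x1; have := between _ _ _ y0 y1.
have := normr_ge0 (f c1); have := normr_ge0 (g c2).
have := normr_ge0 h0; have := normr_ge0 h1 => *; apply/andP; split; lra.
Qed.

(** The region is connected, open, and closed relative to the complement of [D], because its
    boundary lies in [D]; hence it is a whole component. *)
Lemma region_component (D : set (R * R)) :
  (forall y, h0 <= y -> y <= h1 -> D (f y, y) /\ D (g y, y)) ->
  region `&` D = set0 ->
  exists2 z, (~` D) z & region = connected_component (~` D) z.
Proof.
move=> Dfg RD.
have RsD : region `<=` ~` D.
  by move=> z Rz Dz; have : (region `&` D) z by []; rewrite RD.
pose ym := (h0 + h1) / 2.
pose z0 : R * R := (f ym + 1 / 2 * (g ym - f ym), ym).
have Rz0 : region z0 by apply: region_point; have := h01; rewrite /ym; lra.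
exists z0; first exact: RsD.
apply/seteqP; split.
  by apply: connected_component_max => //; exact: connected_region.
have cC := component_connected (A := ~` D) (x := z0).
have CD := @connected_component_sub _ (~` D) z0.
set C := connected_component _ _ in cC CD *.
have <- : C `&` region = C.
  apply: cC.
  - exists z0; split=> //; apply: connected_component_refl; exact: RsD.
  - by exists region => //; exact: open_region.
  (* The closed hull adds only points of the two graphs, all in [D]: at the end heights the graphs
     coincide. *)
  - exists [set z | [/\ h0 <= z.2, z.2 <= h1, f z.2 <= z.1 & z.1 <= g z.2]].
      exact: closed_region_hull.
    apply/seteqP; split=> [z [Cz [? ? ? ?]]|z [Cz [z0' z1 zf zg]]].
      by split=> //; split; exact: ltW.
    split=> //; have nDz := CD _ Cz.
    have [Df Dg] := Dfg _ z0' z1.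
    have nf : z.1 != f z.2.
      by apply/eqP => e; apply: nDz; rewrite -e -surjective_pairing in Df.
    have ng : z.1 != g z.2.
      by apply/eqP => e; apply: nDz; rewrite -e -surjective_pairing in Dg.
    have fne : f z.2 != g z.2.
      by apply: contraNneq nf => e; rewrite eq_le zf andbT e.
    by split; rewrite lt_neqAle ?zf ?zg ?z0' ?z1 ?andbT //;
      [apply: contraNneq fne => <-; rewrite fg0
      |apply: contraNneq fne => ->; rewrite fg1|rewrite eq_sym].
by move=> z [].
Qed.

End Strip.
End Reals.

(** * Directed paths as graphs of continuous functions of the height *)

Section Drawing.
Variables (R : realType) (G : planar_st_digraph R).
Implicit Types (a b u v w : G) (l k p q : seq G) (z : R * R).

Notation ht v := (pos G v).2.
Notation s := (@st_source G).
Notation t := (@st_sink G).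
Notation D := (drawing_points (pos G) (curve G)).

Lemma edge_ht u v : edge u v -> ht u < ht v.
Proof.
move=> uv; rewrite -(curve_start uv) -(curve_end uv).
by apply: (curve_upward uv); rewrite ?ler01 ?ltr01.
Qed.

Lemma path_ht a l v : path edge a l -> v \in l -> ht a < ht v.
Proof.
elim: l a => // b l IH a /= /andP[/edge_ht ab bl].
by rewrite inE => /predU1P[->//|/(IH _ bl)]; exact: lt_trans.
Qed.

Lemma path_ht_le a l v : path edge a l -> v \in a :: l -> ht a <= ht v.
Proof. by move=> al; rewrite inE => /predU1P[->//|/(path_ht al)/ltW]. Qed.

Lemma path_ht_last a l v :
  path edge a l -> v \in a :: l -> ht v <= ht (last a l).
Proof.
elim: l a v => [|b l IH] a v /=; first by rewrite inE => _ /eqP ->.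
move=> /andP[ab bl]; rewrite inE => /predU1P[->|]; last exact: IH.
exact: le_trans (ltW (edge_ht ab)) (IH _ _ bl (mem_head _ _)).
Qed.

Lemma track_connect a l u v : path edge a l -> u \in a :: l -> v \in a :: l ->
  ht u <= ht v -> connect edge u v.
Proof.
elim: l a u v => [|b l IH] a u v /=.
  by rewrite !inE => _ /eqP -> /eqP ->; rewrite connect0.
move=> abl; case/andP: (abl) => ab bl; rewrite inE => /predU1P[->|ul].
  by move=> vin _; exact: (@path_connect _ _ a (b :: l)).
rewrite inE => /predU1P[->|]; last exact: IH.
by move=> /(lt_le_trans (path_ht (l := b :: l) abl ul)); rewrite ltxx.
Qed.

Lemma connect_ht u v : connect edge u v -> ht u <= ht v.
Proof.
case/connectP=> l ul ->; exact: path_ht_le ul (mem_last _ _).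
Qed.

Lemma connect_ht_lt u v : connect edge u v -> u != v -> ht u < ht v.
Proof.
case/connectP=> l ul ->; case: l ul => [|b l] ul; first by rewrite eqxx.
by move=> _; apply: path_ht ul (mem_last b l).
Qed.

(** Recursive counterpart of [path_points], suited to induction and to concatenation; it also allows
    the path without edges, which is a single point. *)
Fixpoint track_points a l : set (R * R) :=
  if l is b :: l' then Defs.arc (curve G) a b `|` track_points b l' else [set pos G a].

Lemma arc_ends u v : edge u v ->
  Defs.arc (curve G) u v (pos G u) /\ Defs.arc (curve G) u v (pos G v).
Proof.
move=> uv; split; [exists 0|exists 1]; rewrite ?curve_start ?curve_end //=;
  by rewrite in_itv /= ?lexx ler01.
Qed.

Lemma arc_cases u v z : edge u v -> Defs.arc (curve G) u v z ->
  [\/ z = pos G u, z = pos G v |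
      exists t : R, [/\ 0 < t, t < 1, curve G u v t = z & ht u < z.2 < ht v]].
Proof.
move=> uv [t]; rewrite /= in_itv /= => /andP[t0 t1] <-.
have [<-|n0] := eqVneq 0 t; first by apply: Or31; rewrite curve_start.
have [->|n1] := eqVneq t 1; first by apply: Or32; rewrite curve_end.
have t0' : 0 < t by rewrite lt_neqAle n0.
have t1' : t < 1 by rewrite lt_neqAle n1.
apply: Or33; exists t; split=> //.
by rewrite -(curve_start uv) -(curve_end uv) !(curve_upward uv) ?lexx.
Qed.

Lemma path_points_track a p b :
  dipath a p b -> path_points a p b = track_points a (rcons p b).
Proof.
elim: p a => [|c p IH] a /=.
  rewrite /dipath /= andbT => ab; apply/seteqP; split=> z.
    by case=> uv; rewrite /= inE => /eqP -> /= ?; left.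
  case=> [?|->]; exists (a, b) => //=; rewrite ?inE //.
  by case: (arc_ends ab).
move=> /andP[ac cpb]; rewrite -IH //; apply/seteqP; split=> z.
  case=> uv; rewrite /= inE => /predU1P[-> ?|uvin ?]; first by left.
  by right; exists uv.
case=> [?|[uv uvin ?]]; first by exists (a, c); rewrite //= inE eqxx.
by exists uv; rewrite //= inE uvin orbT.
Qed.

Lemma track_points_vertex a l v : path edge a l -> v \in a :: l ->
  track_points a l (pos G v).
Proof.
elim: l a => [|b l IH] a /=; first by rewrite inE => _ /eqP ->.
move=> /andP[ab bl]; rewrite inE => /predU1P[->|?]; last by right; exact: IH.
by left; case: (arc_ends ab).
Qed.

Lemma track_points_cat a l k : path edge a (l ++ k) ->
  track_points a (l ++ k) = track_points a l `|` track_points (last a l) k.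
Proof.
elim: l a => [|b l IH] a /=.
  move=> ak; rewrite setUidr // => z ->.
  by apply: track_points_vertex; rewrite ?mem_head.
by move=> /andP[ab blk]; rewrite IH // setUA.
Qed.

(** For a point inside an edge, the whole arc is recorded in order to recognize shared edges, and an
    inner parameter in order to apply planarity. *)
Lemma track_pointsP a l z : path edge a l -> track_points a l z ->
  (exists2 v, v \in a :: l & z = pos G v) \/
  exists u v, [/\ edge u v, u \in a :: l /\ v \in a :: l,
    Defs.arc (curve G) u v `<=` track_points a l &
    exists t : R, [/\ 0 < t, t < 1, curve G u v t = z & ht u < z.2 < ht v]].
Proof.
elim: l a => [|b l IH] a /=; first by move=> _ ->; left; exists a; rewrite ?inE.
move=> /andP[ab bl] [/(arc_cases ab)[->|->|inner]|/(IH _ bl)].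
- by left; exists a; rewrite ?mem_head.
- by left; exists b; rewrite // !inE eqxx orbT.
- right; exists a, b; split=> //; first by rewrite !inE !eqxx orbT.
case=> [[v vl ->]|[u [v [uv [ul vl] sub inner]]]].
  by left; exists v; rewrite // inE vl orbT.
right; exists u, v; split=> //; first by rewrite !(in_cons a) ul vl !orbT.
by move=> ? /sub ?; right.
Qed.

Lemma track_meet a l b k z : path edge a l -> path edge b k ->
  track_points a l z -> track_points b k z ->
  (exists v, [/\ v \in a :: l, v \in b :: k & z = pos G v]) \/
  exists u v, [/\ edge u v, ht u < z.2 < ht v,
    Defs.arc (curve G) u v `<=` track_points a l `&` track_points b k,
    u \in a :: l /\ v \in a :: l & u \in b :: k /\ v \in b :: k].
Proof.
move=> al bk /(track_pointsP al)[[v vl ->]|].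
  case/(track_pointsP bk) => [[w wk /pos_inj vw]|].
    by left; exists v; rewrite vl vw.
  case=> [u [w [uw _ _ [t [t0 t1 /(curve_avoids_vertices uw)]]]]].
  by rewrite t0 t1 => /(_ isT).
case=> u [v [uv [ul vl] sub [t [t0 t1 tz zh]]]].
case/(track_pointsP bk) => [[w wk zw]|].
  by move: tz; rewrite zw => /(curve_avoids_vertices uv); rewrite t0 t1 => /(_ isT).
case=> u' [v' [uv' [uk vk] sub' [t' [t0' t1' tz' _]]]].
right; exists u, v.
have e : (u, v) = (u', v').
  apply: contrapT => ne; have := curve_noncrossing uv uv' ne.
  by move=> /(_ t t'); rewrite t0 t1 t0' t1' => /(_ isT isT); apply; rewrite tz tz'.
by case: e uk vk sub' => <- <- uk vk sub'; split=> // x xa; split; [exact: sub|exact: sub'].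
Qed.

Lemma edge_fun u v : edge u v -> exists f : R -> R, continuous f /\
  forall z, Defs.arc (curve G) u v z <-> [/\ ht u <= z.2, z.2 <= ht v & z.1 = f z.2].
Proof.
move=> uv; rewrite -(curve_start uv) -(curve_end uv).
exact: monotone_curve_graph (curve_continuous uv) (curve_upward uv).
Qed.

Lemma track_fun a l : path edge a l -> exists f : R -> R, continuous f /\
  forall z, track_points a l z <->
            [/\ ht a <= z.2, z.2 <= ht (last a l) & z.1 = f z.2].
Proof.
elim: l a => [|b l IH] a /=.
  move=> _; exists (fun=> (pos G a).1); split; first by move=> ?; exact: cvg_cst.
  move=> z /=; split=> [->|[y0 y1 e]]; first by split.
  rewrite [z]surjective_pairing [pos G a]surjective_pairing e.
  by congr pair; apply/eqP; rewrite eq_le y0 y1.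
move=> /andP[ab bl]; have [f [cf fP]] := edge_fun ab.
have [g [cg gP]] := IH _ bl.
have fb : f (ht b) = (pos G b).1.
  by have [_ /fP[]] := arc_ends ab.
have gb : g (ht b) = (pos G b).1.
  by have /gP[] := track_points_vertex bl (mem_head b l).
(* Gluing at [ht b], where [f] and [g] agree: below it the bracket vanishes, above it the first term
   cancels [f (ht b)]. *)
exists (fun y => f (Num.min (ht b) y) + (g (Num.max (ht b) y) - f (ht b))); split.
  move=> y; apply: cvgD.
    apply: (@continuous_comp _ _ _ (fun y => Num.min (ht b) y) f); last exact: cf.
    by apply: continuous_min; [exact: cvg_cst|exact: cvg_id].
  apply: cvgB; last exact: cvg_cst.
  apply: (@continuous_comp _ _ _ (fun y => Num.max (ht b) y) g); last exact: cg.
  by apply: continuous_max; [exact: cvg_cst|exact: cvg_id].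
have habb := edge_ht ab; have hbl := path_ht_last bl (mem_head b l).
move=> z; case/orP: (le_total z.2 (ht b)) => zb.
- rewrite (min_idPr zb) (max_idPl zb) gb fb subrr addr0; split.
    case=> [/fP[? ? ?]|/gP[zb' ? ?]]; first by split=> //; exact: le_trans hbl.
    have e : z.2 = ht b by apply/eqP; rewrite eq_le zb zb'.
    by split=> //; [rewrite e ltW|rewrite e fb -gb -e].
  by case=> ? ? ?; left; apply/fP.
- rewrite (min_idPl zb) (max_idPr zb) addrC subrK; split.
    case=> [/fP[? zb' ?]|/gP[? ? ?]]; last by split=> //; exact: le_trans (ltW habb) zb.
    have e : z.2 = ht b by apply/eqP; rewrite eq_le zb zb'.
    by split=> //; [rewrite e|rewrite e gb -fb -e].
  by case=> ? ? ?; right; apply/gP.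
Qed.

(** For a directed path the values are forced between the heights of its ends; elsewhere they are
    arbitrary, up to continuity. *)
Definition xtrack a l : R -> R :=
  xget (fun=> 0) [set f | continuous f /\ forall z, track_points a l z <->
            [/\ ht a <= z.2, z.2 <= ht (last a l) & z.1 = f z.2]].

Lemma xtrack_continuous a l : path edge a l -> continuous (xtrack a l).
Proof. by move=> /track_fun/(xgetPex (fun=> 0))[]. Qed.

Lemma xtrackP a l z : path edge a l ->
  track_points a l z <-> [/\ ht a <= z.2, z.2 <= ht (last a l) & z.1 = xtrack a l z.2].
Proof. by move=> /track_fun/(xgetPex (fun=> 0))[]. Qed.

Lemma xtrack_point a l y : path edge a l -> ht a <= y -> y <= ht (last a l) ->
  track_points a l (xtrack a l y, y).
Proof. by move=> al ? ?; apply/(xtrackP _ al). Qed.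

Lemma xtrack_vertex a l v : path edge a l -> v \in a :: l ->
  xtrack a l (ht v) = (pos G v).1.
Proof. by move=> al /(track_points_vertex al)/(xtrackP _ al)[]. Qed.

Lemma xtrack_sub a l b k y : path edge a l -> path edge b k ->
  track_points a l `<=` track_points b k -> ht a <= y -> y <= ht (last a l) ->
  xtrack a l y = xtrack b k y.
Proof.
by move=> al bk sub y0 y1; have /sub/(xtrackP _ bk)[] := xtrack_point al y0 y1.
Qed.

Lemma xtrack_catl a l k y : path edge a (l ++ k) ->
  ht a <= y -> y <= ht (last a l) -> xtrack a (l ++ k) y = xtrack a l y.
Proof.
move=> alk; have := alk; rewrite cat_path => /andP[al _].
move=> y0 y1; apply/esym/xtrack_sub => //.
by rewrite track_points_cat // => ?; left.
Qed.

Lemma xtrack_catr a l k y : path edge a (l ++ k) ->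
  ht (last a l) <= y -> y <= ht (last a (l ++ k)) ->
  xtrack a (l ++ k) y = xtrack (last a l) k y.
Proof.
move=> alk; have := alk; rewrite cat_path => /andP[_ lk].
rewrite last_cat => y0 y1; apply/esym/xtrack_sub => //.
by rewrite track_points_cat // => ?; right.
Qed.

Lemma arc_gap u v w : edge u v -> Defs.arc (curve G) u v (pos G w) ->
  ht u < ht w -> ht w < ht v -> False.
Proof.
move=> uv /(arc_cases uv)[/pos_inj ->|/pos_inj ->|]; rewrite ?ltxx //.
case=> t [t0 t1 e _] _ _; apply: curve_avoids_vertices uv _ _ e.
by rewrite t0.
Qed.

(** The track has one point at each height, so [w] would lie on the arc itself, strictly between its
    ends. *)
Lemma track_gap a l u v w : path edge a l -> edge u v -> w \in a :: l ->
  Defs.arc (curve G) u v `<=` track_points a l ->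
  ht u < ht w -> ht w < ht v -> False.
Proof.
move=> al uv wl sub uw wv; apply: (arc_gap uv _ uw wv).
have [f [_ fP]] := edge_fun uv.
have fw : Defs.arc (curve G) u v (f (ht w), ht w) by apply/fP; split=> //; exact: ltW.
have /sub/(xtrackP _ al)[/= _ _] := fw.
by rewrite xtrack_vertex // => e; rewrite [pos G w]surjective_pairing -e.
Qed.

(** Follow the first track up to the meeting point and the second from there on. Inside a common
    edge the switch is made at its upper end, which [track_gap] keeps no higher than [w]. *)
Lemma meet_connect a l b k z u w : path edge a l -> path edge b k ->
  track_points a l z -> track_points b k z -> u \in a :: l -> w \in b :: k ->
  ht u <= z.2 -> z.2 <= ht w -> connect edge u w.
Proof.
move=> al bk zl zk ul wk uz zw; case: (track_meet al bk zl zk).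
  case=> v [vl vk zv]; rewrite zv in uz zw.
  exact: connect_trans (track_connect al ul vl uz) (track_connect bk vk wk zw).
case=> u' [v [uv /andP[uz' zv] sub [_ vl] [_ vk]]].
have uv' : ht u <= ht v by apply: le_trans uz (ltW zv).
have vw : ht v <= ht w.
  rewrite leNgt; apply/negP; apply: (track_gap bk uv wk); last exact: lt_le_trans zw.
  by move=> ? /sub[].
exact: connect_trans (track_connect al ul vl uv') (track_connect bk vk wk vw).
Qed.

(** * Bigons formed by two tracks *)

(** If the tracks meet strictly between their ends, they share an edge there, which must join the
    two ends, so they coincide. If they never meet, the intermediate value theorem fixes their
    order. *)
Lemma bigon_sign a l k : path edge a l -> path edge a k ->
  last a l = last a k -> (forall c, c \in l -> c \in k -> c = last a l) ->
  [\/ forall y, ht a <= y -> y <= ht (last a l) -> xtrack a l y = xtrack a k y,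
      forall y, ht a < y -> y < ht (last a l) -> xtrack a l y < xtrack a k y |
      forall y, ht a < y -> y < ht (last a l) -> xtrack a k y < xtrack a l y].
Proof.
move=> al ak elk dis; set b := last a l in elk dis *.
have [[y [y0 y1 ye]]|] :=
  pselect (exists y, [/\ ht a < y, y < ht b & xtrack a l y = xtrack a k y]).
  apply: Or31.
  have common v : v \in a :: l -> v \in a :: k -> v = a \/ v = b.
    rewrite !inE => /orP[/eqP ->|vl]; first by left.
    by case/orP=> [/eqP ->|vk]; [left|right; exact: dis].
  have yl := xtrack_point al (ltW y0) (ltW y1).
  have yk := xtrack_point ak (ltW y0); rewrite -elk -ye in yk.
  case: (track_meet al ak yl (yk (ltW y1))).
    case=> v [vl vk /(congr1 snd)/= ev]; move: y0 y1.
    by case: (common v vl vk) => <-; rewrite ev ltxx.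
  case=> u [v [uv /= /andP[uy yv] sub [ul vl] [uk vk]]].
  have ua : u = a.
    case: (common u ul uk) => // ub; move: (lt_trans uy y1).
    by rewrite ub ltxx.
  have vb : v = b.
    case: (common v vl vk) => // va; move: (lt_trans y0 yv).
    by rewrite va ltxx.
  subst u v; move=> {y0 y1 uy yv yl yk ye} y y0 y1.
  have [f [_ fP]] := edge_fun uv.
  have /sub[/(xtrackP _ al)[/= _ _ <-] /(xtrackP _ ak)[/= _ _ <-]] //:
    Defs.arc (curve G) a b (f y, y) by apply/fP.
move=> /forallNP ne.
have [ab|] := ltP (ht a) (ht b); last first.
  move=> ba; apply: Or32 => y y0 y1.
  by have := lt_le_trans (lt_trans y0 y1) ba; rewrite ltxx.
pose m := (ht a + ht b) / 2.
have am : ht a < m by rewrite /m; lra.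
have mb : m < ht b by rewrite /m; lra.
have cl := xtrack_continuous al; have ck := xtrack_continuous ak.
have nomix y y' : ht a < y -> y < ht b -> ht a < y' -> y' < ht b ->
    xtrack a l y <= xtrack a k y -> xtrack a k y' <= xtrack a l y' -> False.
  move=> y0 y1 y0' y1' h h'; have [x [x0 x1 xe]] := cross cl ck h h'.
  apply: (ne x); split=> //.
    by apply: lt_le_trans x0; rewrite lt_min y0.
  by apply: le_lt_trans x1 _; rewrite gt_max y1.
have [h|h] := leP (xtrack a l m) (xtrack a k m).
  by apply: Or32 => y y0 y1; rewrite ltNge; apply/negP; exact: nomix h.
apply: Or33 => y y0 y1; rewrite ltNge; apply/negP => h'.
exact: nomix h' (ltW h).
Qed.

(* Pointwise maxima and minima of tracks with common ends are tracks: swap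
   the two tracks at the vertices where they meet. *)
Lemma track_lattice a l k : path edge a l -> path edge a k ->
  last a l = last a k -> exists m n,
  [/\ path edge a m /\ last a m = last a l,
      path edge a n /\ last a n = last a l,
      forall y, ht a <= y -> y <= ht (last a l) ->
        xtrack a m y = Num.max (xtrack a l y) (xtrack a k y) &
      forall y, ht a <= y -> y <= ht (last a l) ->
        xtrack a n y = Num.min (xtrack a l y) (xtrack a k y)].
Proof.
have [N leN] := ubnP (size l); elim: N => // N IH in a l k leN *.
move=> al ak elk.
(* A common vertex [c] other than the end splits both tracks, and each half is treated by
   induction. *)
have [[c [cl ck cb]]|] := pselect (exists c, [/\ c \in l, c \in k & c != last a l]).
  case/path.splitP: cl al elk cb leN => l1 l2 al elk cb leN.
  case/path.splitP: ck ak elk => k1 k2 ak elk.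
  have := al; have := ak; rewrite !cat_path => /andP[ak1 ak2] /andP[al1 al2].
  move: elk cb ak2 al2 leN; rewrite !last_cat !last_rcons => elk cb ak2 al2.
  rewrite size_cat size_rcons => leN.
  have [||||m1 [n1 [[am1 em1] [an1 en1] M1 N1]]] := IH a (rcons l1 c) (rcons k1 c) => //.
  - case: l2 cb leN {al elk al2} => [|? ? _]; first by rewrite eqxx.
    by rewrite size_rcons ltnS; apply: leq_trans; rewrite addnS ltnS leq_addr.
  - by rewrite !last_rcons.
  have [|m2 [n2 [[am2 em2] [an2 en2] M2 N2]]] := IH c l2 k2 _ al2 ak2 elk.
    by move: leN; rewrite ltnS addSn; apply: leq_trans; rewrite ltnS leq_addl.
  rewrite !last_rcons in em1 en1 M1 N1.
  have am : path edge a (m1 ++ m2) by rewrite cat_path am1 em1.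
  have an : path edge a (n1 ++ n2) by rewrite cat_path an1 en1.
  exists (m1 ++ m2), (n1 ++ n2); split.
  - by rewrite last_cat em1.
  - by rewrite last_cat en1.
  - move=> y y0 y1; have [yc|/ltW cy] := leP y (ht c).
      by rewrite !xtrack_catl ?last_rcons ?em1 // M1.
    by rewrite !xtrack_catr ?last_cat ?last_rcons ?em1 ?em2 -?elk // M2.
  - move=> y y0 y1; have [yc|/ltW cy] := leP y (ht c).
      by rewrite !xtrack_catl ?last_rcons ?en1 // N1.
    by rewrite !xtrack_catr ?last_cat ?last_rcons ?en1 ?en2 -?elk // N2.
move=> /forallNP dis.
have ends y : ht a <= y -> y <= ht (last a l) ->
    ~ (ht a < y /\ y < ht (last a l)) -> xtrack a l y = xtrack a k y.
  move=> y0 y1 /not_andP[/negP|/negP]; rewrite -leNgt => y2.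
    have -> : y = ht a by apply/eqP; rewrite eq_le y2.
    by rewrite !xtrack_vertex ?mem_head.
  have -> : y = ht (last a l) by apply/eqP; rewrite eq_le y1.
  by rewrite xtrack_vertex ?mem_last // elk xtrack_vertex ?mem_last.
(* Without such a vertex the tracks coincide or one lies on one side of the other. *)
case: (bigon_sign al ak elk).
- by move=> c cl ck; apply/eqP/negPn/negP => cb; apply: (dis c).
- move=> e; exists l, l; split=> // y y0 y1; rewrite (e _ y0 y1).
    by rewrite maxxx.
  by rewrite minxx.
- move=> lt; have le y : ht a <= y -> y <= ht (last a l) -> xtrack a l y <= xtrack a k y.
    move=> y0 y1; have [[? ?]|/(ends _ y0 y1) ->//] :=
      pselect (ht a < y /\ y < ht (last a l)).
    by apply: ltW; exact: lt.
  by exists k, l; split=> // y y0 y1; rewrite ?(max_idPr (le _ _ _)) ?(min_idPl (le _ _ _)).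
- move=> lt; have le y : ht a <= y -> y <= ht (last a l) -> xtrack a k y <= xtrack a l y.
    move=> y0 y1; have [[? ?]|/(ends _ y0 y1) ->//] :=
      pselect (ht a < y /\ y < ht (last a l)).
    by apply: ltW; exact: lt.
  by exists l, k; split=> // y y0 y1; rewrite ?(max_idPl (le _ _ _)) ?(min_idPr (le _ _ _)).
Qed.

(** Cut both tracks at a common vertex and keep the parts whose heights span [y0], until only the
    ends are shared. The height of a common vertex is never [y0], as the tracks differ there. *)
Lemma bigon_around a l k y0 : path edge a l -> path edge a k ->
  last a l = last a k -> ht a < y0 -> y0 < ht (last a l) ->
  xtrack a l y0 != xtrack a k y0 -> exists a' l' k',
  [/\ path edge a' l' /\ path edge a' k', last a' l' = last a' k',
      forall c, c \in l' -> c \in k' -> c = last a' l',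
      [/\ ht a <= ht a', ht a' < y0, y0 < ht (last a' l') &
        ht (last a' l') <= ht (last a l)] &
      forall y, ht a' <= y -> y <= ht (last a' l') ->
        xtrack a' l' y = xtrack a l y /\ xtrack a' k' y = xtrack a k y].
Proof.
have [N leN] := ubnP (size l); elim: N => // N IH in a l k leN *.
move=> al ak elk ya yb ne.
have [[c [cl ck cb]]|] := pselect (exists c, [/\ c \in l, c \in k & c != last a l]);
  last first.
  move=> /forallNP dis; exists a, l, k; split=> // c cl ck.
  by apply/eqP/negPn/negP => cb; apply: (dis c).
case/path.splitP: cl al elk yb cb leN ne => l1 l2 al elk yb cb leN.
case/path.splitP: ck ak elk => k1 k2 ak elk ne.
have := al; have := ak; rewrite !cat_path => /andP[ak1 ak2] /andP[al1 al2].
move: (elk) (cb) (yb) ak2 al2 leN; rewrite !last_cat !last_rcons => elk' cb' yb' ak2 al2.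
rewrite size_cat size_rcons => leN.
have hc1 : ht a <= ht c by apply: path_ht_le al1 _; rewrite inE mem_rcons mem_head orbT.
have hc2 : ht c <= ht (last c l2) by apply: path_ht_last al2 (mem_head _ _).
have [yc|cy|e] := ltgtP y0 (ht c).
- have [|||||||a' [l' [k' [paths e' dis' [aa' ay yb'' bc] E]]]] :=
    IH a (rcons l1 c) (rcons k1 c) => //.
  + case: l2 cb' leN {al elk al2 yb cb elk' ne yb' hc2} => [|? ? _]; first by rewrite eqxx.
    by rewrite size_rcons ltnS; apply: leq_trans; rewrite addnS ltnS leq_addr.
  + by rewrite !last_rcons.
  + by rewrite last_rcons.
  + by move: ne; rewrite !xtrack_catl ?last_rcons // ltW.
  rewrite last_rcons in bc; exists a', l', k'; split=> //.
    by split=> //; rewrite ?last_cat ?last_rcons; exact: le_trans hc2.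
  move=> y y1 y2; have [-> ->] := E _ y1 y2.
  by rewrite !xtrack_catl ?last_rcons ?(le_trans aa') ?(le_trans y2).
- have [||||a' [l' [k' [paths e' dis' [aa' ay yb'' bc] E]]]] :=
    IH c l2 k2 _ al2 ak2 elk' => //.
  + by move: leN; rewrite ltnS addSn; apply: leq_trans; rewrite ltnS leq_addl.
  + by move: ne; rewrite !xtrack_catr ?last_cat ?last_rcons -?elk' // ltW.
  exists a', l', k'; split=> //.
    by split=> //; rewrite ?last_cat ?last_rcons //; exact: le_trans aa'.
  move=> y y1 y2; have [-> ->] := E _ y1 y2.
  by rewrite !xtrack_catr ?last_cat ?last_rcons -?elk' ?(le_trans aa') ?(le_trans y2).
- move: ne; rewrite e !xtrack_vertex ?eqxx //; 
    by rewrite inE mem_cat mem_rcons mem_head ?orbT.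
Qed.

(** * Faces *)

(** Every vertex other than [s] has a predecessor, which is strictly lower; the number of lower
    vertices drives the induction. *)
Lemma connect_source v : connect edge s v.
Proof.
have [N] := ubnP #|[set w | ht w < ht v]%SET|; elim: N v => // N IH v.
have [->|vs] := eqVneq v s; first by rewrite connect0.
have /card_gt0P[u] : (0 < #|[set u | edge u v]%SET|)%N.
  by rewrite lt0n; apply/eqP => /st_sourceP/eqP; rewrite (negPf vs).
rewrite finset.inE => uv leN; apply: connect_trans _ (connect1 uv); apply: IH.
rewrite ltnS in leN; apply: leq_trans leN; apply: proper_card.
apply/fintype.properP; split.
  apply/fintype.subsetP => w; rewrite !finset.inE => /lt_trans; apply.
  exact: edge_ht.
by exists u; rewrite finset.inE ?ltxx // edge_ht.
Qed.

Lemma connect_sink v : connect edge v t.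
Proof.
have [N] := ubnP #|[set w | ht v < ht w]%SET|; elim: N v => // N IH v.
have [->|vt] := eqVneq v t; first by rewrite connect0.
have /card_gt0P[u] : (0 < #|[set u | edge v u]%SET|)%N.
  by rewrite lt0n; apply/eqP => /st_sinkP/eqP; rewrite (negPf vt).
rewrite finset.inE => vu leN; apply: connect_trans (connect1 vu) _; apply: IH.
rewrite ltnS in leN; apply: leq_trans leN; apply: proper_card.
apply/fintype.properP; split.
  apply/fintype.subsetP => w; rewrite !finset.inE; apply: lt_trans.
  exact: edge_ht.
by exists u; rewrite finset.inE ?ltxx // edge_ht.
Qed.

Definition st_track l := path edge s l /\ last s l = t.

Lemma st_track_edge u v : edge u v -> exists l,
  [/\ st_track l, u \in s :: l, v \in s :: l &
      Defs.arc (curve G) u v `<=` track_points s l].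
Proof.
move=> uv.
have /connectP[l sl lu] := connect_source u; have /connectP[k vk kt] := connect_sink v.
have slk : path edge s (l ++ v :: k) by rewrite cat_path sl /= -lu uv.
exists (l ++ v :: k); split.
- by split=> //; rewrite last_cat.
- by rewrite -cat_cons mem_cat lu mem_last.
- by rewrite in_cons mem_cat mem_head !orbT.
- by rewrite track_points_cat // -lu => z ?; right; left.
Qed.

Lemma st_track_vertex v : s != t -> exists2 l, st_track l & v \in s :: l.
Proof.
move=> st; have /connectP[[|c k] /= vk kt] := connect_sink v.
  have /connectP[l sl lv] := connect_source v.
  by exists l; [split; rewrite // -lv|rewrite lv mem_last].
case/andP: vk => /st_track_edge[l [sl vl _ _]] _; by exists l.
Qed.

(** A vertex below the height of the sink has an outgoing edge, so even vertices lie on some arc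
    here. *)
Lemma drawing_st_track z : D z -> z.2 < ht t -> exists u v l,
  [/\ edge u v, Defs.arc (curve G) u v z, st_track l &
      Defs.arc (curve G) u v `<=` track_points s l].
Proof.
move=> Dz zt; have [u [v [uv zuv]]] : exists u v, edge u v /\ Defs.arc (curve G) u v z.
  case: Dz => // -[v zv]; rewrite zv in zt *.
  have /connectP[[|c k] /= vk kt] := connect_sink v.
    by move: zt; rewrite kt ltxx.
  by case/andP: vk => vc _; exists v, c; split=> //; case: (arc_ends vc).
by have [l [? _ _ ?]] := st_track_edge uv; exists u, v, l.
Qed.

Lemma track_points_sub a l : path edge a l -> track_points a l `<=` D.
Proof.
move=> al z /(track_pointsP al)[[v _ ->]|]; first by left; exists v.
case=> u [v [uv _ _ [r [r0 r1 e _]]]]; right; exists u, v; split=> //.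
by exists r; rewrite //= in_itv /= !ltW.
Qed.

Lemma stripP a p q b z : dipath a p b -> dipath a q b ->
  strip a p q b z <-> [/\ ht a <= z.2, z.2 <= ht b,
    xtrack a (rcons p b) z.2 < z.1 & z.1 < xtrack a (rcons q b) z.2].
Proof.
move=> ap aq; rewrite /strip !path_points_track //; split.
  case=> -[x /(xtrackP _ ap)[/= y0 y1 ->] xz] [x' /(xtrackP _ aq)[/= _ _ ->] zx'].
  by rewrite last_rcons in y1.
by case=> y0 y1 lz zr; split; [exists (xtrack a (rcons p b) z.2)
  |exists (xtrack a (rcons q b) z.2)] => //; apply: xtrack_point;
  rewrite ?last_rcons.
Qed.

Lemma dipath_ht a p b : dipath a p b -> ht a < ht b.
Proof. by move=> ap; apply: path_ht ap _; rewrite mem_rcons mem_head. Qed.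

Lemma dipath_inner a p b c : dipath a p b -> c \in p -> ht a < ht c /\ ht c < ht b.
Proof.
rewrite /dipath rcons_path => /andP[ap pb] cp; split; first exact: path_ht ap cp.
by apply: le_lt_trans (path_ht_last ap _) (edge_ht pb); rewrite inE cp orbT.
Qed.

Lemma xtrack_start a p b : dipath a p b -> xtrack a (rcons p b) (ht a) = (pos G a).1.
Proof. by move=> ap; rewrite xtrack_vertex ?mem_head. Qed.

Lemma xtrack_end a p b : dipath a p b -> xtrack a (rcons p b) (ht b) = (pos G b).1.
Proof. by move=> ap; rewrite xtrack_vertex ?in_cons ?mem_rcons ?mem_head ?orbT. Qed.

Lemma strip_internal_face a p q b : dipath a p b -> dipath a q b ->
  (forall y, ht a < y -> y < ht b ->
     xtrack a (rcons p b) y < xtrack a (rcons q b) y) ->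
  strip a p q b `&` D = set0 -> internal_face G (strip a p q b).
Proof.
move=> ap aq lr.
have cp := xtrack_continuous ap; have cq := xtrack_continuous aq.
have e0 : xtrack a (rcons p b) (ht a) = xtrack a (rcons q b) (ht a).
  by rewrite !xtrack_start.
have e1 : xtrack a (rcons p b) (ht b) = xtrack a (rcons q b) (ht b).
  by rewrite !xtrack_end.
(* [strip] admits the two end heights, but there the sides coincide and nothing lies strictly
   between them. *)
have -> : strip a p q b =
    region (xtrack a (rcons p b)) (xtrack a (rcons q b)) (ht a) (ht b).
  apply/seteqP; split=> z; last first.
    by case=> *; apply/stripP => //; split=> //; exact: ltW.
  case/stripP => // y0 y1 zl zr; have pq := lt_trans zl zr; split=> //.
    rewrite lt_neqAle y0 andbT; apply: contraTneq pq => <-.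
    by rewrite e0 ltxx.
  rewrite lt_neqAle y1 andbT; apply: contraTneq pq => ->.
  by rewrite e1 ltxx.
move=> SD; split; last exact: bounded_region cp cq (dipath_ht ap).
apply: region_component => //; first exact: dipath_ht ap.
by move=> y y0 y1; split; [apply: (track_points_sub ap)|apply: (track_points_sub aq)];
  apply: xtrack_point; rewrite ?last_rcons.
Qed.

(** The cardinals of these finite sets measure the position of an s-t track: moving it to the right
    can only shrink [right_of], to the left only [left_of]. *)
Let right_of l : pred (G * G) := fun e => `[< edge e.1 e.2 /\
  exists2 z, Defs.arc (curve G) e.1 e.2 z & xtrack s l z.2 < z.1 >].
Let left_of l : pred (G * G) := fun e => `[< edge e.1 e.2 /\
  exists2 z, Defs.arc (curve G) e.1 e.2 z & z.1 < xtrack s l z.2 >].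

Lemma arc_range u v z : edge u v -> Defs.arc (curve G) u v z ->
  ht s <= z.2 /\ z.2 <= ht t.
Proof.
move=> uv /(arc_cases uv) zuv.
have hs w : ht s <= ht w by apply: connect_ht; exact: connect_source.
have htt w : ht w <= ht t by apply: connect_ht; exact: connect_sink.
case: zuv => [->|->|[r [_ _ _ /andP[uz zv]]]]; split=> //.
  exact: le_trans (hs u) (ltW uz).
exact: le_trans (ltW zv) (htt v).
Qed.

Lemma face_right x0 y0 l1 k1 : st_track l1 -> st_track k1 ->
  D (x0, y0) -> ht s < y0 -> y0 < ht t ->
  xtrack s l1 y0 <= x0 -> x0 < xtrack s k1 y0 ->
  exists a p q b, [/\ internal_face G (strip a p q b),
    face_sides (strip a p q b) a p q b, ht a < y0 /\ y0 < ht b,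
    xtrack a (rcons p b) y0 = x0 & x0 < xtrack a (rcons q b) y0].
Proof.
move=> sl0 sk0 D0 ys yt l0 k0.
(* [l] is the rightmost track [P], in the sense that fewest edges have a point to its right; [k] is
   likewise the leftmost track [Q]. *)
have [l [[sl ly] lmin]] := @ex_min_measure (seq G)
  (fun l => st_track l /\ xtrack s l y0 <= x0) (fun l => #|right_of l|)
  (ex_intro _ l1 (conj sl0 l0)).
have [k [[sk ky] kmin]] := @ex_min_measure (seq G)
  (fun l => st_track l /\ x0 < xtrack s l y0) (fun l => #|left_of l|)
  (ex_intro _ k1 (conj sk0 k0)).
have [pl el] := sl; have [pk ek] := sk.
have elk : last s l = last s k by rewrite ek.
have ne : xtrack s l y0 != xtrack s k y0 by rewrite lt_eqF // (le_lt_trans ly).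
rewrite -el in yt.
(* The face will be the bigon of [l] and [k] around the height [y0]. *)
have [a [l' [k' [[al ak] elk' dis [sa ay yb bt] E]]]] := bigon_around pl pk elk ys yt ne.
case/lastP: l' al elk' dis yb bt E => [|p b] al elk' dis yb bt E.
  by move: (lt_trans ay yb); rewrite ltxx.
rewrite last_rcons in elk' dis yb bt E.
case/lastP: k' ak elk' dis E => [|q b'] ak elk' dis E.
  by move: (lt_trans ay yb); rewrite elk' ltxx.
rewrite last_rcons in elk'; subst b'.
have ap : dipath a p b := al; have aq : dipath a q b := ak.
have [ay' yb'] := (ltW ay, ltW yb).
have [Ep Eq] := E _ ay' yb'.
have lr : forall y, ht a < y -> y < ht b ->
     xtrack a (rcons p b) y < xtrack a (rcons q b) y.
  have := bigon_sign al ak; rewrite !last_rcons => /(_ erefl dis)[e|//|gt].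
    by move: ne; rewrite -Ep -Eq (e _ ay' yb') eqxx.
  move: (gt _ ay yb); rewrite Ep Eq => /lt_trans /(_ (le_lt_trans ly ky)).
  by rewrite ltxx.
have SD : strip a p q b `&` D = set0.
  rewrite -subset0 => z [/(stripP _ ap aq)[z0 z1]]; have [-> ->] := E _ z0 z1.
  move=> lz zk Dz.
  have zt : z.2 < ht t.
    rewrite -el lt_neqAle (le_trans z1 bt) andbT.
    apply: contraTneq (lt_trans lz zk) => ->.
    by rewrite xtrack_vertex ?mem_last // elk xtrack_vertex ?mem_last // ltxx.
  have [u [v [m [uv zuv [pm em] sub]]]] := drawing_st_track Dz zt.
  have uvE z' : Defs.arc (curve G) u v z' -> z'.1 = xtrack s m z'.2.
    by move=> /sub/(xtrackP _ pm)[].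
  have elm : last s l = last s m by rewrite em.
  have ekm : last s k = last s m by rewrite em.
  have ys' := ltW ys; have yt' := ltW yt.
  (* The maximum of [l] and [m] is still at most [x0] at height [y0], but it loses the edge [(u, v)]
     from [right_of]: this edge reaches right of [l] at [z] and lies on [m]. *)
  case: (leP (xtrack s m y0) x0) => my.
    have [n [_ [[pn en] _ nE _]]] := track_lattice pl pm elm.
    have sn : st_track n by split; rewrite // en.
    have ny : xtrack s n y0 <= x0 by rewrite nE // ge_max ly.
    have := lmin _ (conj sn ny); rewrite leqNgt => /negP; apply.
    apply: proper_card; apply/fintype.properP; split.
      apply/fintype.subsetP => e /asboolP[ee [z' ez' nz']]; apply/asboolP.
      split=> //; exists z' => //; apply: le_lt_trans nz'.
      have [r0 r1] := arc_range ee ez'; rewrite nE ?le_max ?lexx //.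
      by rewrite el.
    exists (u, v); first by apply/asboolP; split=> //; exists z.
    apply/asboolP => -[_ /= [z' ez']]; have [r0 r1] := arc_range uv ez'.
    by rewrite nE ?el // gt_max (uvE _ ez') ltxx andbF.
  (* Symmetrically, the minimum of [k] and [m] loses [(u, v)] from [left_of]. *)
  have [_ [n [_ [pn en] _ nE]]] := track_lattice pk pm ekm.
  rewrite -elk in nE en.
  have sn : st_track n by split; rewrite // en.
  have ny : x0 < xtrack s n y0 by rewrite nE // lt_min ky.
  have := kmin _ (conj sn ny); rewrite leqNgt => /negP; apply.
  apply: proper_card; apply/fintype.properP; split.
    apply/fintype.subsetP => e /asboolP[ee [z' ez' nz']]; apply/asboolP.
    split=> //; exists z' => //; apply: lt_le_trans nz' _.
    have [r0 r1] := arc_range ee ez'; rewrite nE ?ge_min ?lexx //.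
    by rewrite el.
  exists (u, v); first by apply/asboolP; split=> //; exists z.
  apply/asboolP => -[_ /= [z' ez']]; have [r0 r1] := arc_range uv ez'.
  by rewrite nE ?el // lt_min (uvE _ ez') ltxx andbF.
exists a, p, q, b; split=> //.
- exact: strip_internal_face.
- split=> //; apply/hasPn => c cq; apply/negP => cp.
  have cb : c = b.
    apply: dis; rewrite mem_rcons inE ?cq ?orbT //.
    by rewrite [X in _ || X](cp : c \in p) orbT.
  by have [_] := dipath_inner ap cp; rewrite cb ltxx.
(* Were the left side strictly left of [x0], the drawing point [(x0, y0)] would lie in the strip. *)
- apply/eqP; rewrite eq_le {1}Ep ly /= leNgt; apply/negP => lx.
  suff: (strip a p q b `&` D) (x0, y0) by rewrite SD.
  by split=> //; apply/stripP => //; split=> //=; rewrite Eq.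
- by rewrite Eq.
Qed.

(** * Rhombi *)

Lemma internal_face_off (F : set (R * R)) z : internal_face G F -> F z -> ~ D z.
Proof. by case=> -[z0 _ ->] _ /connected_component_sub. Qed.

Lemma internal_face_neq0 (F : set (R * R)) : internal_face G F -> F !=set0.
Proof. by case=> -[z0 ? ->] _; exists z0; exact: connected_component_refl. Qed.

(** A face is nonempty, and any point of it shows the correct order of the sides at one height;
    [bigon_sign] extends this order to all inner heights. *)
Lemma face_sides_lt (F : set (R * R)) a p q b :
  internal_face G F -> face_sides F a p q b ->
  forall y, ht a < y -> y < ht b ->
    xtrack a (rcons p b) y < xtrack a (rcons q b) y.
Proof.
move=> /internal_face_neq0[z Fz] [ap aq dis FE].
rewrite FE in Fz; have [z0 z1 zl zr] := (stripP z ap aq).1 Fz.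
have lr := lt_trans zl zr.
have dis' c : c \in rcons p b -> c \in rcons q b -> c = last a (rcons p b).
  rewrite last_rcons !mem_rcons !inE => /predU1P[//|cp] /predU1P[//|cq].
  by case/hasP: dis; exists c.
have := bigon_sign ap aq _ dis'; rewrite !last_rcons => /(_ erefl)[e|//|gt].
  by rewrite e // ltxx in lr.
suff /lt_trans/(_ lr) : xtrack a (rcons q b) z.2 < xtrack a (rcons p b) z.2.
  by rewrite ltxx.
apply: gt; rewrite lt_neqAle ?z0 ?z1 andbT; apply: contraTneq lr.
  by move=> <-; rewrite !xtrack_start // ltxx.
by move=> ->; rewrite !xtrack_end // ltxx.
Qed.

Lemma track_points1 a b : edge a b -> track_points a [:: b] = Defs.arc (curve G) a b.
Proof. by move=> ab /=; apply: setUidl => z ->; case: (arc_ends ab). Qed.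

Lemma edge_path a b : edge a b -> path edge a [:: b].
Proof. by move=> ab; rewrite /= ab. Qed.

(** Neither [a] nor [b] is at the height [y], so the meeting takes place inside a common edge, which
    can only be [(a, b)]. *)
Lemma edge_meet a b l c y : edge a b -> path edge c l -> ht a < y -> y < ht b ->
  track_points c l (xtrack a [:: b] y, y) ->
  Defs.arc (curve G) a b `<=` track_points c l.
Proof.
move=> ab cl ya yb yl.
have eb := edge_path ab; have ye := xtrack_point eb (ltW ya) (ltW yb).
case: (track_meet eb cl ye yl).
  case=> v [+ _ /(congr1 snd) /= vy]; rewrite !inE => /orP[]/eqP ve.
    by move: ya; rewrite vy ve ltxx.
  by move: yb; rewrite vy ve ltxx.
case=> u [v [uv /= /andP[uy yv] sub [ul vl] _]].
have ua : u = a.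
  move: ul; rewrite !inE => /orP[]/eqP // ub.
  by move: (lt_trans uy yb); rewrite ub ltxx.
have vb : v = b.
  move: vl; rewrite !inE => /orP[]/eqP // va.
  by move: (lt_trans ya yv); rewrite va ltxx.
by rewrite ua vb in sub => z /sub[].
Qed.

(** * Hamiltonian paths exclude rhombi *)

Lemma hamiltonian_no_weak : hamiltonian_path G -> ~ weak_rhombus G.
Proof.
move=> [c [r [cr _ all_r]]] [F [a [b [p [q [iF sF p0 q0]]]]]].
have lr := face_sides_lt iF sF; case: sF => ap aq _ FE.
case: p p0 lr ap FE => // u p _ lr ap FE; case: q q0 lr aq FE => // w q _ lr aq FE.
have up : u \in u :: p by rewrite mem_head.
have wq : w \in w :: q by rewrite mem_head.
have [au ub] := dipath_inner ap up; have [aw wb] := dipath_inner aq wq.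
have cl := xtrack_continuous ap; have cq := xtrack_continuous aq.
(* The midline of the face separates [u] from [w], so the hamiltonian path meets it, at an inner
   height and thus inside the face. *)
pose M y := (xtrack a (rcons (u :: p) b) y + xtrack a (rcons (w :: q) b) y) / 2.
have cM : continuous M.
  move=> y; apply: cvgM; last exact: cvg_cst.
  by apply: cvgD; [exact: cl|exact: cq].
have uM : xtrack c r (ht u) <= M (ht u).
  have := lr _ au ub; rewrite /M (xtrack_vertex cr) // (xtrack_vertex ap).
    by move=> ?; lra.
  by rewrite inE mem_rcons inE up !orbT.
have wM : M (ht w) <= xtrack c r (ht w).
  have := lr _ aw wb; rewrite /M (xtrack_vertex cr) // (xtrack_vertex aq).
    by move=> ?; lra.
  by rewrite inE mem_rcons inE wq !orbT.
have [y [y0 y1 ye]] := cross (xtrack_continuous cr) cM uM wM.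
have ya : ht a < y by apply: lt_le_trans y0; rewrite lt_min au.
have yb : y < ht b by apply: le_lt_trans y1 _; rewrite gt_max ub.
apply: (internal_face_off iF (z := (M y, y))).
  rewrite FE; apply/stripP => //; rewrite /M /=; have := lr _ ya yb.
  by move=> ?; split; rewrite ?ltW //; lra.
rewrite -ye; apply: (track_points_sub cr); apply: xtrack_point => //.
  by apply: le_trans y0; rewrite le_min !(path_ht_le cr).
by apply: le_trans y1 _; rewrite ge_max !(path_ht_last cr).
Qed.

(** A crossing with the middle edge forces the path to contain that edge; yet the path also visits
    [u], whose height is strictly between those of the ends of the edge. *)
Lemma hamiltonian_no_strong : hamiltonian_path G -> ~ strong_rhombus G.
Proof.
move=> [c [r [cr _ all_r]]].
move=> [a [b [F [F' [ab [iF [p p0 sF]] [iF' [q q0 sF']]]]]]].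
have lt1 := face_sides_lt iF sF; have lt2 := face_sides_lt iF' sF'.
case: sF => ap _ _ _; case: sF' => _ aq _ _.
case: p p0 lt1 ap => // u p _ lt1 ap; case: q q0 lt2 aq => // w q _ lt2 aq.
have up : u \in u :: p by rewrite mem_head.
have wq : w \in w :: q by rewrite mem_head.
have [au ub] := dipath_inner ap up; have [aw wb] := dipath_inner aq wq.
have ue : xtrack c r (ht u) <= xtrack a [:: b] (ht u).
  rewrite (xtrack_vertex cr) // -(xtrack_vertex ap); first exact/ltW/lt1.
  by rewrite inE mem_rcons inE up !orbT.
have we : xtrack a [:: b] (ht w) <= xtrack c r (ht w).
  rewrite (xtrack_vertex cr) // -(xtrack_vertex aq); first exact/ltW/lt2.
  by rewrite inE mem_rcons inE wq !orbT.
have [y [y0 y1 ye]] := cross (xtrack_continuous cr)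
  (xtrack_continuous (edge_path ab)) ue we.
have ya : ht a < y by apply: lt_le_trans y0; rewrite lt_min au.
have yb : y < ht b by apply: le_lt_trans y1 _; rewrite gt_max ub.
apply: (track_gap cr ab (all_r u) _ au ub); apply: (edge_meet ab cr ya yb).
rewrite -ye; apply: xtrack_point => //.
  by apply: le_trans y0; rewrite le_min !(path_ht_le cr).
by apply: le_trans y1 _; rewrite ge_max !(path_ht_last cr).
Qed.

Lemma track_vertex_mem a l v : path edge a l -> track_points a l (pos G v) ->
  v \in a :: l.
Proof.
move=> al /(track_pointsP al)[[w wl /pos_inj -> //]|].
case=> u [w [uw _ _ [r [r0 r1 e _]]]].
by case: (curve_avoids_vertices uw (a := r) _ e); rewrite r0.
Qed.

(** * Incomparable vertices force a rhombus *)

Definition incomparable u w := ~~ connect edge u w && ~~ connect edge w u.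

(* Sweep rightwards along the height of [w] from one triangle to the next. *)
Lemma triangle_chain (F : set (R * R)) a b w : edge a b -> left_sided_triangle F a b ->
  ht a < ht w -> ht w < ht b -> xtrack a [:: b] (ht w) < (pos G w).1 ->
  strong_rhombus G \/ weak_rhombus G.
Proof.
(* Edges that cross the height of [w] strictly between the abscissa [x] and [w]; their number drops
   at each step of the sweep. *)
pose between x : pred (G * G) := fun e => [&& edge e.1 e.2, ht e.1 < ht w,
  ht w < ht e.2, x < xtrack e.1 [:: e.2] (ht w) &
  xtrack e.1 [:: e.2] (ht w) < (pos G w).1].
have [N] := ubnP #|between (xtrack a [:: b] (ht w))|.
elim: N => // N IH in F a b *; rewrite ltnS => leN ab Fab aw wb xw.
have eb := edge_path ab.
have sw : ht s < ht w by apply: le_lt_trans aw; apply: connect_ht; exact: connect_source.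
have wt : ht w < ht t by apply: lt_le_trans wb _; apply: connect_ht; exact: connect_sink.
have st : s != t by apply: contraTneq (lt_trans sw wt) => ->; rewrite ltxx.
have [l [sl _ _ sub]] := st_track_edge ab.
have [k sk wk] := st_track_vertex w st.
have xl : xtrack a [:: b] (ht w) = xtrack s l (ht w).
  by apply: xtrack_sub; rewrite ?track_points1 ?ltW //; case: sl.
have xk : xtrack s k (ht w) = (pos G w).1 by apply: xtrack_vertex wk; case: sk.
have Dx : D (xtrack a [:: b] (ht w), ht w).
  by apply: (track_points_sub eb); apply: xtrack_point; rewrite ?ltW.
have [||a' [p [q [b' [iF sF [a'w wb'] xp xq]]]]] := face_right sl sk Dx sw wt.
- by rewrite xl.
- by rewrite xk.
(* Otherwise the vertex [w] would lie inside the face. *)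
have qw : xtrack a' (rcons q b') (ht w) <= (pos G w).1.
  rewrite leNgt; apply/negP => wq; case: sF => ap aq _ _.
  apply: (internal_face_off iF (z := pos G w)); last by left; exists w.
  by apply/stripP => //; rewrite xp; split=> //; exact: ltW.
(* If the right side has inner vertices, either the left side has some too, or it is a single edge.
   In the latter case that edge is [(a, b)] and the two triangles form a strong rhombus. *)
case: q sF iF xq qw => [|c q] sF iF xq qw; last first.
  case: p sF iF xp => [|d p] sF iF xp; last first.
    by right; exists (strip a' (d :: p) (c :: q) b'), a', b', (d :: p), (c :: q).
  have [a'b' _ _ _] := sF; rewrite /dipath /= andbT in a'b'.
  have : track_points a' [:: b'] (xtrack a [:: b] (ht w), ht w).
    by rewrite -xp; apply: xtrack_point; rewrite ?ltW //; exact: edge_path.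
  move=> /(edge_meet ab (edge_path a'b') aw wb) {}sub.
  have [aa aa'] := arc_ends ab.
  have := track_vertex_mem (edge_path a'b') (sub _ aa).
  have := track_vertex_mem (edge_path a'b') (sub _ aa').
  rewrite !inE => /orP[]/eqP bE; first by move: a'w; rewrite -bE ltNge (ltW wb).
  case/orP => /eqP aE; last by move: wb'; rewrite -aE ltNge (ltW aw).
  subst a' b'; left; exists a, b, F, (strip a [::] (c :: q) b); split=> //.
  by split=> //; exists (c :: q).
have [_ a'b' _ _] := sF; rewrite /dipath /= andbT in a'b'.
(* The left side has inner vertices, because the two sides differ at the height of [w]. *)
have Fab' : left_sided_triangle (strip a' p [::] b') a' b'.
  by split=> //; exists p => // p0; rewrite p0 in xp; rewrite -xp ltxx in xq.
have qw' : xtrack a' [:: b'] (ht w) < (pos G w).1.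
  rewrite lt_neqAle qw andbT; apply/eqP => e.
  apply: (arc_gap a'b' _ a'w wb'); rewrite -track_points1 //.
  rewrite [pos G w]surjective_pairing -e; apply: xtrack_point; rewrite ?ltW //.
  exact: edge_path.
apply: (IH (strip a' p [::] b') a' b') => //; apply: leq_trans leN; apply: proper_card.
apply/fintype.properP; split.
  apply/fintype.subsetP => e; rewrite !unfold_in /between => /and5P[-> -> -> ? ->].
  by rewrite (lt_trans xq).
by exists (a', b'); rewrite unfold_in /between /= ?a'b' ?a'w ?wb' ?xq ?qw' // ltxx !andbF.
Qed.

(** The face to the right of [u] has [u] inside its left side. Unless it gives a weak rhombus, its
    right side is an edge; closeness makes this edge span the height of [w], and the sweep starts
    there. *)
Lemma rhombus_of_closest_pair u w l k : incomparable u w ->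
  (forall u' w', incomparable u' w' -> `|ht u - ht w| <= `|ht u' - ht w'|) ->
  st_track l -> st_track k -> u \in s :: l -> w \in s :: k ->
  xtrack s l (ht u) < xtrack s k (ht u) -> xtrack s l (ht w) < xtrack s k (ht w) ->
  strong_rhombus G \/ weak_rhombus G.
Proof.
move=> /andP[nuw nwu] closest sl sk ul wk ltu ltw.
have [[pl _] [pk _]] := (sl, sk).
have su : ht s < ht u.
  apply: connect_ht_lt (connect_source u) _; apply: contraNneq nuw => <-.
  exact: connect_source.
have ut : ht u < ht t.
  apply: connect_ht_lt (connect_sink u) _; apply: contraNneq nwu => ->.
  exact: connect_sink.
have xu := xtrack_vertex pl ul; have xw := xtrack_vertex pk wk.
have Du : D ((pos G u).1, ht u) by left; exists u; rewrite -surjective_pairing.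
have [||a [p [q [b [iF sF [au ub] xp xq]]]]] := face_right sl sk Du su ut.
- by rewrite xu.
- by rewrite -xu.
have [ap aq _ _] := sF.
have upb : u \in a :: rcons p b.
  apply: track_vertex_mem => //; apply/(xtrackP _ ap); split; rewrite ?ltW //.
  by rewrite last_rcons.
have up : u \in p.
  move: upb; rewrite inE mem_rcons inE => /or3P[/eqP e|/eqP e|//].
    by rewrite e ltxx in au.
  by rewrite e ltxx in ub.
have p0 : p <> [::] by move=> p0; rewrite p0 in up.
case: q sF iF xq aq => [|c q] sF iF xq aq; last first.
  by right; exists (strip a p (c :: q) b), a, b, p, (c :: q).
have ab : edge a b by move: aq; rewrite /dipath /= andbT.
have cub : connect edge u b.
  apply: track_connect ap upb _ (ltW ub); first by rewrite in_cons mem_rcons mem_head orbT.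
have cau : connect edge a u by apply: track_connect ap (mem_head _ _) upb (ltW au).
(* Otherwise [b] and [w] would be incomparable and closer in height than [u] and [w]; the same
   argument serves for [a] below. *)
have wb : ht w < ht b.
  rewrite ltNge; apply/negP => bw.
  have := closest b w; rewrite /incomparable.
  have -> : ~~ connect edge b w.
    by apply: contra nuw; exact: connect_trans.
  have -> : ~~ connect edge w b.
    apply/negP => cwb; have [wb|wb] := eqVneq w b; first by rewrite wb cub in nuw.
    by have := connect_ht_lt cwb wb; rewrite ltNge bw.
  rewrite distrC [X in _ <= X]distrC ger0_norm; last by rewrite subr_ge0 ltW // (lt_le_trans ub).
  rewrite ger0_norm ?subr_ge0 // => /(_ isT); lra.
have aw : ht a < ht w.
  rewrite ltNge; apply/negP => wa.
  have := closest a w; rewrite /incomparable.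
  have -> : ~~ connect edge w a.
    by apply: contra nwu => /connect_trans; apply.
  have -> : ~~ connect edge a w.
    apply/negP => caw; have [wa'|wa'] := eqVneq a w; first by rewrite -wa' cau in nwu.
    by have := connect_ht_lt caw wa'; rewrite ltNge wa.
  rewrite ger0_norm; last by rewrite subr_ge0 ltW // (le_lt_trans wa).
  rewrite ger0_norm ?subr_ge0 // => /(_ isT); lra.
apply: (triangle_chain (F := strip a p [::] b) ab _ aw wb); first by split=> //; exists p.
(* Otherwise [k], which is not left of the edge at the height of [u], would meet the edge, hence
   contain it, and could not have the vertex [w] at an inner height. *)
rewrite ltNge; apply/negP => we.
have eu : xtrack a [:: b] (ht u) <= xtrack s k (ht u).
  rewrite leNgt; apply/negP => ke.
  apply: (internal_face_off iF (z := (xtrack s k (ht u), ht u))).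
    by apply/stripP => //=; rewrite xp -xu; split=> //; exact: ltW.
  apply: (track_points_sub pk); apply: xtrack_point; rewrite ?ltW //.
  by case: sk => _ ->.
rewrite -xw in we.
have eb := edge_path ab.
have [y [y0 y1 ye]] := cross (xtrack_continuous eb) (xtrack_continuous pk) eu we.
have ya : ht a < y by apply: lt_le_trans y0; rewrite lt_min au.
have yb : y < ht b by apply: le_lt_trans y1 _; rewrite gt_max ub.
apply: (track_gap pk ab wk _ aw wb); apply: (edge_meet ab pk ya yb).
rewrite ye; apply: xtrack_point => //.
  by apply: le_trans (ltW ya); apply: connect_ht; exact: connect_source.
by case: sk => _ ->; apply: le_trans (ltW yb) _; apply: connect_ht; exact: connect_sink.
Qed.

(** By [meet_connect], a meeting at such a height would connect the lower of the two vertices to the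
    higher. *)
Lemma incomparable_tracks_disjoint u w l k y : incomparable u w ->
  st_track l -> st_track k -> u \in s :: l -> w \in s :: k ->
  Num.min (ht u) (ht w) <= y -> y <= Num.max (ht u) (ht w) ->
  xtrack s l y != xtrack s k y.
Proof.
move=> /andP[nuw nwu] [pl el] [pk ek] ul wk y0 y1; apply/eqP => e.
have ys : ht s <= y by apply: le_trans y0; rewrite le_min !(connect_ht (connect_source _)).
have yt : y <= ht t by apply: le_trans y1 _; rewrite ge_max !(connect_ht (connect_sink _)).
have yl := xtrack_point pl ys; have yk := xtrack_point pk ys.
rewrite el in yl; rewrite ek -e in yk.
case/orP: (le_total (ht u) (ht w)) => uw.
  rewrite (min_idPl uw) in y0; rewrite (max_idPr uw) in y1.
  by case/negP: nuw; exact: meet_connect pl pk (yl yt) (yk yt) ul wk y0 y1.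
rewrite (min_idPr uw) in y0; rewrite (max_idPl uw) in y1.
by case/negP: nwu; exact: meet_connect pk pl (yk yt) (yl yt) wk ul y0 y1.
Qed.

(** For a closest pair, the tracks stay apart between the two heights, so their left-right order is
    the same at both; exchanging [u] and [w] covers the other order. *)
Lemma rhombus_of_incomparable u0 w0 : incomparable u0 w0 ->
  strong_rhombus G \/ weak_rhombus G.
Proof.
move=> uw0; pose P := [pred e : G * G | incomparable e.1 e.2].
pose d (e : G * G) := `|ht e.1 - ht e.2|.
have Pe0 : P (u0, w0) by [].
case: (arg_minP d Pe0) => -[u w] uw closest.
have {}closest u' w' : incomparable u' w' -> `|ht u - ht w| <= `|ht u' - ht w'|.
  exact: (closest (u', w')).
have {}uw : incomparable u w := uw.
have st : s != t.
  apply: contraTneq uw => e; rewrite negb_and !negbK.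
  by rewrite (connect_trans (connect_sink u)) // -e connect_source.
have [l sl ul] := st_track_vertex u st; have [k sk wk] := st_track_vertex w st.
have [pl pk] := (sl.1, sk.1).
have sep := incomparable_tracks_disjoint uw sl sk ul wk.
have sepu : xtrack s l (ht u) != xtrack s k (ht u).
  by apply: sep; rewrite ?ge_min ?le_max lexx.
have sepw : xtrack s l (ht w) != xtrack s k (ht w).
  by apply: sep; rewrite ?ge_min ?le_max lexx orbT.
have [cl ck] := (xtrack_continuous pl, xtrack_continuous pk).
have closest' u' w' : incomparable u' w' -> `|ht w - ht u| <= `|ht u' - ht w'|.
  by rewrite [X in X <= _]distrC; exact: closest.
have wu : incomparable w u by rewrite /incomparable andbC.
move: sepu sepw; rewrite !neq_lt => /orP[ltu|gtu] /orP[ltw|gtw].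
- exact: rhombus_of_closest_pair closest sl sk ul wk ltu ltw.
- have [y [y0 y1 /eqP e]] := cross cl ck (ltW ltu) (ltW gtw).
  by have := sep y y0 y1; rewrite e.
- have [y [y0 y1 /eqP e]] := cross ck cl (ltW gtu) (ltW ltw).
  by have := sep y y0 y1; rewrite eq_sym e.
- exact: rhombus_of_closest_pair closest' sk sl wk ul gtw gtu.
Qed.

(** * A hamiltonian path by sorting the vertices by height *)

(** Heights are distinct, and a directed path joining two consecutive vertices in the order of
    heights has no room for a third one, so it is an edge. *)
Lemma hamiltonian_of_comparable :
  (forall u w, ~~ incomparable u w) -> hamiltonian_path G.
Proof.
move=> cmp.
have cmp' u w : ht u < ht w -> connect edge u w.
  move=> uw; have := cmp u w; rewrite negb_and !negbK => /orP[//|/connect_ht].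
  by rewrite leNgt uw.
have ht_inj : injective (fun v => ht v).
  move=> u w e; apply/eqP/negPn/negP => uw.
  have := cmp u w; rewrite negb_and !negbK => /orP[] /connect_ht_lt.
    by rewrite e ltxx => /(_ uw).
  by rewrite e ltxx eq_sym => /(_ uw).
have step p x : path (fun u w => ht u < ht w) x p ->
    (forall v, ht x < ht v -> v \in p) -> path edge x p.
  elim: p x => //= y p IH x /andP[xy yp] above.
  apply/andP; split; last first.
    apply: IH => // v yv; have := above _ (lt_trans xy yv).
    by rewrite inE => /predU1P[e|//]; rewrite e ltxx in yv.
  (* The first vertex [c] after [x] on a directed path to [y] is higher than [x], so it is [y] or
     comes later in [p]; in the latter case it would be higher than the end [y] of that path. *)
  case/connectP: (cmp' _ _ xy) => -[|c r] /= xr ye; first by rewrite ye ltxx in xy.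
  case/andP: xr => xc cr; have := above _ (edge_ht xc).
  rewrite inE => /predU1P[<-//|cp].
  have yc : ht y < ht c.
    have tr : transitive (fun u w : G => ht u < ht w) by move=> ? ? ?; exact: lt_trans.
    exact: (allP (order_path_min tr yp)).
  by have := path_ht_last cr (mem_head _ _); rewrite -ye leNgt yc.
(* Sorting yields a weak order; injectivity of the heights makes it strict. *)
pose r := fun u w : G => ht u <= ht w.
have := sort_sorted (leT := r) (fun u w => le_total _ _) (enum G).
have := sort_uniq r (enum G); rewrite enum_uniq.
have mem_all v : v \in sort r (enum G) by rewrite mem_sort mem_enum.
case: (sort r (enum G)) mem_all => [/(_ s)//|x p] mem_all uxp xp.
exists x, p; split=> //; apply: step.
  have : sorted r (x :: p) by [].
  move: uxp {mem_all xp}; rewrite /sorted.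
  elim: p x => //= y p IH x /andP[xyp yp] /andP[xy rp].
  rewrite (IH _ yp rp) andbT lt_neqAle (xy : ht x <= ht y) andbT; apply/eqP => /ht_inj e.
  by rewrite e mem_head in xyp.
by move=> v xv; have := mem_all v; rewrite inE => /predU1P[e|//]; rewrite e ltxx in xv.
Qed.

End Drawing.

Theorem theorem1 (R : realType) (G : planar_st_digraph R) :
  hamiltonian_path G <-> (~ strong_rhombus G /\ ~ weak_rhombus G).
Proof.
split=> [ham|[nstrong nweak]].
  by split; [exact: hamiltonian_no_strong|exact: hamiltonian_no_weak].
apply: (@hamiltonian_of_comparable R) => u w; apply/negP.
by move=> /rhombus_of_incomparable[].
Qed.
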